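(* Suppose that $r\in\mathbb N$ and $g\in\mathcal E$ satisfy $T^rg=g$. Then $g=h$.
   Context: ''Decreasing'' means non-increasing; $\int f:=\int_0^1 f(x)\,dx$. Let $\mathcal M$ be the set of measurable $f\colon[0,1]\to[0,\infty)$ with $\int f>0$, and $\mathcal E$ the set of decreasing $f\in\mathcal M$ with $f(0)=1$. For $g\in\mathcal E$ its pseudo-inverse is $g^*(y):=\sup\{x\in[0,1]: g(x)\ge y\}$ for $y\in[0,1]$; then $g^*\in\mathcal E$ and $\int g^*=\int g$. Define the operator $T$ on $\mathcal E$ by $(Tf)(x)=\frac{\int_x^1 f^*}{\int f}$ for $x\in[0,1]$, with iterates $T^n=T\circ T^{n-1}$, $T^0=\mathrm{id}$. Let $h_0\equiv1$ on $[0,1]$ and $h_n:=T^nh_0$. The sequence $(h_n)$ converges uniformly on $[0,1]$; let $h$ denote its limit (it satisfies $Th=h$). *)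

(* Defs.v *)
(* over an arbitrary realType R.
   Functions [0,1] -> [0,oo) are represented as R -> R; only their values
   on [0,1] matter (all constructions below only look at [0,1]). *)
From HB Require Import structures.
From mathcomp Require Import all_boot all_order all_algebra.
From mathcomp Require Import all_classical all_reals all_analysis.
Set Implicit Arguments. Unset Strict Implicit. Unset Printing Implicit Defensive.
Import Order.TTheory GRing.Theory Num.Theory numFieldNormedType.Exports.
Local Open Scope classical_set_scope.
Local Open Scope ring_scope.

Section Defs.
Variable R : realType.

Definition unit_itv : set R := `[0%R, 1%R]%classic.

Definition leb := (@lebesgue_measure R).

Definition int01 (f : R -> R) : \bar R := (\int[leb]_(x in unit_itv) (f x)%:E)%E.

Definition in_M (f : R -> R) : Prop :=
  measurable_fun unit_itv f /\
  (forall x, x \in unit_itv -> 0 <= f x) /\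
  (0 < int01 f)%E.

Definition decreasing01 (f : R -> R) : Prop :=
  forall x y, x \in unit_itv -> y \in unit_itv -> x <= y -> f y <= f x.

Definition in_E (f : R -> R) : Prop :=
  in_M f /\ decreasing01 f /\ f 0 = 1.

Definition pinv (g : R -> R) : R -> R :=
  fun y => sup [set x | x \in unit_itv /\ y <= g x].

Definition Tmap (f : R -> R) : R -> R :=
  fun x => Rintegral leb `[x, 1%R]%classic (pinv f) / Rintegral leb unit_itv f.

Definition h0 : R -> R := fun _ => 1.

Definition hseq (n : nat) : R -> R := iter n Tmap h0.

(* h = the (uniform, hence pointwise) limit of h_n *)
Definition hlim : R -> R := fun x => limn (fun n => hseq n x).

End Defs.

(* Main.v *)
(** For decreasing [f] on [0, oo) put [S f x := int_x^oo f^*].  [S] is equivariant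
    under the scalings [g_{a,b}(x) := a g(x / b)], namely
    [S g_{a,b} = (S g)_{ab,a}], and it does not increase the number of sign
    changes of a difference, since neither reflection in the diagonal nor
    taking tails does.  A decreasing [f] minus a scaled copy of [h_0] (a box)
    has sign pattern at most [+ - +]; hence so has [T^n f] minus any scaled copy
    of [h_n].  Stretching [h_n] slightly beyond the support of [T^n f] excludes
    one crossing more and shows that [T^n f / h_n] is decreasing.

    So a function [g] with [T^r g = g], and each [T^k g], has a decreasing ratio
    to every [h_n], in particular [T^k g <= h_n]; likewise [h_n] is decreasing
    in [n].  Let [c] denote the integral and [H] the limit of [c(h_n)].
    Comparing [f = T^k g] with [a h_n], where [a = c(f) / c(h_n)], the graphs
    cross once and have equal integrals, so [T f >= (T h_n)(. / a)]; integrating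
    and letting [n] grow, [c(T f) >= c(f) + int_{c(f)/H}^1 T f].  Going once
    around the cycle forces [c(g) = H], and then [g <= h_n] together with the
    decreasing ratio gives [g = lim h_n]. *)
Require Import Defs.
From HB Require Import structures.
From mathcomp Require Import all_boot all_order all_algebra.
From mathcomp Require Import all_classical all_reals all_analysis.
From mathcomp Require Import measurable_realfun ring lra.
Import Order.TTheory GRing.Theory Num.Theory numFieldNormedType.Exports.
Set Implicit Arguments.
Unset Strict Implicit.
Unset Printing Implicit Defensive.
Local Open Scope classical_set_scope.
Local Open Scope ring_scope.

(* [functions.pinv] shadows the pseudo-inverse. *)
Local Notation pinv := Defs.pinv.

(** * Integrals of monotone functions *)

Section Integral.
Context {R : realType}.
Implicit Types (f g : R -> R) (s t u a b c x y : R).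

Definition itvint f s t : R := Rintegral (@leb R) `[s, t]%classic f.

Lemma nonincreasing_integrable f s t : nonincreasing_fun f ->
  (@leb R).-integrable `[s, t]%classic (EFin \o f).
Proof.
move=> nf; apply: measurable_bounded_integrable.
- exact: measurable_itv.
- by rewrite /leb /= lebesgue_measure_itv /=; case: ifP => _; rewrite -?EFinB ltry.
- exact: nonincreasing_measurable.
- exists (`|f s| + `|f t|); split; first exact: num_real.
  move=> M ltM x /=; rewrite in_itv /= => /andP[sx xt].
  apply: le_trans (ltW ltM).
  have := nf _ _ sx; have := nf _ _ xt.
  have := ler_norm (f s); have := ler_norm (- f t); rewrite normrN.
  have := normr_ge0 (f s); have := normr_ge0 (f t).
  by rewrite ler_norml => *; apply/andP; split; lra.
Qed.

Lemma itvint_cat f s t u : nonincreasing_fun f -> s <= t -> t <= u ->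
  itvint f s u = itvint f s t + itvint f t u.
Proof.
move=> nf st tu.
have := @Rintegral_itvB R f (BLeft s) (BRight u) t (nonincreasing_integrable s u nf).
rewrite !bnd_simp => /(_ st tu).
rewrite Rintegral_itv_obnd_cbnd => [|].
  by rewrite /itvint /leb => <-; rewrite addrC subrK.
apply: integrableS (nonincreasing_integrable s u nf) => //.
by apply: subset_itvr; rewrite bnd_simp.
Qed.

Lemma itvint_empty f s t : t < s -> itvint f s t = 0.
Proof.
by move=> ts; rewrite /itvint set_itv_ge ?Rintegral_set0// bnd_simp -ltNge.
Qed.

Lemma itvint_cst c s t : s <= t -> itvint (fun=> c) s t = c * (t - s).
Proof.
move=> st; rewrite /itvint Rintegral_cst//= /leb /= lebesgue_measure_itv /=.
by rewrite lte_fin; case: ltgtP st => // -> _; rewrite subrr.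
Qed.

Lemma itvint_ge0 f s t : (forall x, s <= x <= t -> 0 <= f x) ->
  0 <= itvint f s t.
Proof. by move=> f0; apply: Rintegral_ge0 => x /=; rewrite in_itv; exact: f0. Qed.

(** The endpoint [s] is a null set and may be left out, so comparisons known only for [x > 0]
    suffice and witnesses lie strictly to the right of [s]. *)
Lemma le_itvint f g s t : nonincreasing_fun f -> nonincreasing_fun g ->
  (forall x, s < x <= t -> f x <= g x) -> itvint f s t <= itvint g s t.
Proof.
move=> nf ng fg.
have int h : nonincreasing_fun h ->
    (@leb R).-integrable `]s, t]%classic (EFin \o h).
  move=> nh; apply: integrableS (nonincreasing_integrable s t nh) => //.
  by apply: subset_itvr; rewrite bnd_simp.
rewrite /itvint /leb -!Rintegral_itv_obnd_cbnd; [|exact: int..].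
by apply: le_Rintegral => //; exact: int.
Qed.

Lemma itvintZ c f s t : nonincreasing_fun f ->
  itvint (fun x => c * f x) s t = c * itvint f s t.
Proof.
move=> nf; rewrite /itvint RintegralZl//; exact: nonincreasing_integrable.
Qed.

Lemma itvint_witness f g s t : nonincreasing_fun f -> nonincreasing_fun g ->
  itvint f s t < itvint g s t -> exists2 x, s < x <= t & f x < g x.
Proof.
move=> nf ng fg; apply: contrapT => /forall2NP H.
move: fg; rewrite ltNge => /negP; apply; apply: le_itvint => // x sxt.
by case: (H x) => [//|/negP]; rewrite -leNgt.
Qed.

Lemma itvint_lower f s t : nonincreasing_fun f -> s <= t ->
  f t * (t - s) <= itvint f s t.
Proof.
move=> nf st; rewrite -itvint_cst//; apply: le_itvint => //.
by move=> x /andP[_ xt]; exact: nf.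
Qed.

Lemma itvint_upper f s t : nonincreasing_fun f -> s <= t ->
  itvint f s t <= f s * (t - s).
Proof.
move=> nf st; rewrite -itvint_cst//; apply: le_itvint => //.
by move=> x /andP[/ltW sx _]; exact: nf.
Qed.

Lemma itvint_gt0 f s t : nonincreasing_fun f -> s < t -> 0 <= f t ->
  (forall x, x < t -> 0 < f x) -> 0 < itvint f s t.
Proof.
move=> nf st ft f0; pose m := (s + t) / 2.
have sm : s < m by rewrite /m; lra.
have mt : m < t by rewrite /m; lra.
rewrite (itvint_cat nf (ltW sm) (ltW mt)).
have I1 : 0 <= itvint f m t.
  by apply: itvint_ge0 => y /andP[_ yt]; apply: le_trans ft _; exact: nf.
have I0 := itvint_lower nf (ltW sm).
apply: ltr_wpDr => //; apply: lt_le_trans I0.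
by rewrite mulr_gt0 ?f0// subr_gt0.
Qed.

(** * Change of scale *)

Lemma nonincreasing_comp_div f b : 0 < b -> nonincreasing_fun f ->
  nonincreasing_fun (fun x => f (x / b)).
Proof. by move=> b0 nf x y xy; apply: nf; rewrite ler_pM2r// invr_gt0. Qed.

Definition divmap b : measurableTypeR R -> measurableTypeR R := fun x => x / b.

Lemma measurable_divmap b : measurable_fun setT (divmap b).
Proof. by apply: measurable_funM => //; exact: measurable_cst. Qed.

Lemma preimage_div (i : interval R) b : 0 < b ->
  divmap b @^-1` [set` i] =
  [set` Interval
    (match i.1 with BSide e x => BSide e (x * b) | BInfty e => BInfty R e end)
    (match i.2 with BSide e x => BSide e (x * b) | BInfty e => BInfty R e end)].
Proof.
move=> b0; apply/seteqP; split => x; case: i => -[[] ?|[]] [[] ?|[]] //=;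
  by rewrite /divmap /= !in_itv /= ?(ler_pdivlMr,ltr_pdivlMr,ler_pdivrMr,ltr_pdivrMr).
Qed.

(** Uniqueness of Lebesgue measure: [b^-1] times the pushforward gives every half-open interval its
    length. *)
Lemma lebesgue_measure_div b (b0 : 0 < b) (A : set R) : measurable A ->
  pushforward (@leb R) (divmap b) A = (b%:E * leb A)%E.
Proof.
move=> mA.
have binv0 : 0 <= b^-1 by rewrite invr_ge0 ltW.
have E : leb A = ((b^-1)%:E * pushforward (@leb R) (divmap b) A)%E.
  have := @lebesgue_measure_unique R
    (mscale (NngNum binv0) (pushforward (@leb R) (divmap b))).
  move=> /(_ (measurable_divmap b)) H.
  rewrite [LHS]H// => _ [[s t]] _ <-.
  transitivity ((b^-1)%:E * leb (divmap b @^-1` `]s, t]%classic))%E => //.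
  rewrite preimage_div//= /leb !lebesgue_measure_itv/=.
  rewrite !lte_fin ltr_pM2r//; case: ifP => _; last by rewrite mule0.
  by rewrite -!EFinB -EFinM -mulrBl mulrCA mulVf ?mulr1// gt_eqF.
by rewrite E muleA -EFinM mulfV ?mul1e// gt_eqF.
Qed.

Lemma itvint_scale f b s t : 0 < b -> nonincreasing_fun f ->
  (forall x, 0 <= f x) ->
  itvint (fun x => f (x / b)) s t = b * itvint f (s / b) (t / b).
Proof.
move=> b0 nf f0; have b0' : 0 <= b by exact: ltW.
have mf : measurable_fun `[s / b, t / b]%classic (EFin \o f).
  by apply/measurable_EFinP; exact: nonincreasing_measurable.
rewrite /itvint /Rintegral.
have -> : (\int[@leb R]_(x in `[s, t]) (f (x / b))%:E =
    b%:E * \int[@leb R]_(x in `[(s / b)%R, (t / b)%R]%classic) (f x)%:E)%E.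
  transitivity (\int[pushforward (@leb R) (divmap b)]_(x in
      `[(s / b)%R, (t / b)%R]%classic)
      (f x)%:E)%E.
    rewrite ge0_integral_pushforward//.
    - by rewrite preimage_div//= !divfK// gt_eqF.
    - exact: measurable_divmap.
    - by move=> x _; rewrite lee_fin.
  transitivity (\int[mscale (NngNum b0') (@leb R)]_(x in `[(s / b)%R, (t / b)%R]%classic)
      (f x)%:E)%E.
    apply: eq_measure_integral => [|mb A mA _]; first exact: measurable_divmap.
    by rewrite [LHS](lebesgue_measure_div b0 mA).
  by rewrite ge0_integral_mscale// => x _; rewrite lee_fin.
rewrite fineM//; apply: integrable_fin_num => //.
exact: nonincreasing_integrable.
Qed.

End Integral.

(** * The pseudo-inverse *)

Section PseudoInverse.
Context {R : realType}.
Implicit Types (f g : R -> R) (s t x y : R).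

Lemma mem_unit_itv x : (x \in @unit_itv R) = (0 <= x <= 1).
Proof. by rewrite /unit_itv mem_setE in_itv. Qed.

(** When no point reaches the height [y] this set is empty, and the default value 0 of [sup] is the
    one wanted. *)
Let pset f y := [set x | x \in @unit_itv R /\ y <= f x].

Let pset_ub f y : ubound (pset f y) 1.
Proof. by move=> x [/=]; rewrite mem_unit_itv => /andP[]. Qed.

Lemma pinv_ge f x y : 0 <= x <= 1 -> y <= f x -> x <= pinv f y.
Proof.
move=> x01 yfx; apply: ub_le_sup; first by exists 1; exact: pset_ub.
by rewrite /= mem_unit_itv.
Qed.

Lemma pinv_le1 f y : pinv f y <= 1.
Proof.
rewrite /pinv -/(pset f y).
case: (pselect (pset f y !=set0)) => [ne|/nonemptyPn e].
  exact: ge_sup (@pset_ub f y).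
by rewrite e sup0.
Qed.

Lemma pinv_ge0 f y : 0 <= pinv f y.
Proof.
case: (pselect (pset f y !=set0)) => [[x [x01 yfx]]|/nonemptyPn e].
  move: x01; rewrite mem_unit_itv => x01.
  by case/andP: (x01) => x0 _; apply: le_trans x0 _; exact: pinv_ge.
by rewrite /pinv -/(pset f y) e sup0.
Qed.

(** With [lt_of_pinv_lt] this locates the graph on both sides of [pinv f y]; at that abscissa itself
    nothing is decided, as [f] need not be semicontinuous. *)
Lemma le_of_lt_pinv f t y : nonincreasing_fun f -> 0 <= t -> t < pinv f y ->
  y <= f t.
Proof.
move=> nf t0 ty; case: (pselect (pset f y !=set0)) => [ne|/nonemptyPn e].
  have [x [_ yfx] tx] := sup_gt ne ty.
  by apply: le_trans yfx _; apply: nf; exact: ltW.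
by move: ty; rewrite /pinv -/(pset f y) e sup0 ltNge t0.
Qed.

Lemma lt_of_pinv_lt f t y : 0 <= t <= 1 -> pinv f y < t -> f t < y.
Proof. by move=> t01; apply: contraTT; rewrite -!leNgt; exact: pinv_ge. Qed.

Lemma pinv_nonincreasing f : nonincreasing_fun (pinv f).
Proof.
move=> y z yz.
case: (pselect (pset f z !=set0)) => [ne|/nonemptyPn e]; last first.
  by rewrite {1}/pinv -/(pset f z) e sup0 pinv_ge0.
apply: ge_sup => // x [/=]; rewrite mem_unit_itv => x01 zfx.
by apply: pinv_ge => //; exact: le_trans zfx.
Qed.

Lemma pinv_eq0 f y : nonincreasing_fun f -> f 0 < y -> pinv f y = 0.
Proof.
move=> nf fy; apply/eqP; rewrite eq_le pinv_ge0 andbT leNgt; apply/negP => p0.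
by move: fy; rewrite ltNge (le_of_lt_pinv nf (lexx 0) p0).
Qed.

(* Both sides are the area of [{(x, y) | 0 <= x <= 1, 0 <= y <= f x}]. *)
Lemma itvint_pinv f : nonincreasing_fun f -> f 0 <= 1 -> 0 <= f 1 ->
  itvint (pinv f) 0 1 = itvint f 0 1.
Proof.
move=> nf f0 f1.
pose T := measurableTypeR R.
pose A : set (T * T) :=
  (`[0, 1]%classic `*` `[0, 1]%classic) `&` [set p | p.2 <= f p.1].
have mA : measurable A.
  apply: measurable_fun_le.
  - exact: measurableX.
  - by apply: measurable_funTS.
  - apply: measurable_funTS; apply: measurableT_comp.
      exact: nonincreasing_measurable.
    exact: measurable_fst.
have := @indic_fubini_tonelli _ _ _ _ R (@leb R) (@leb R) A mA.
rewrite indic_fubini_tonelli_FE// indic_fubini_tonelli_GE// => E.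
rewrite /itvint /Rintegral; congr fine.
rewrite integral_mkcond [RHS]integral_mkcond.
transitivity (\int[@leb R]_y (leb (ysection A y)))%E.
  apply: eq_integral => y _ /=; rewrite patchE; case: ifPn => y01; last first.
    suff -> : ysection A y = set0 by rewrite /leb measure0.
    rewrite -subset0 => x.
    rewrite /ysection /= inE => -[[_ /= y01'] _].
    by move/negP: y01; apply; rewrite inE.
  have my : measurable (ysection A y) by exact: measurable_ysection.
  (* The right endpoint may or may not belong to the section, which is therefore squeezed between
     the half-open and the closed interval. *)
  have leb0 (e : bool) :
      leb ([set` Interval (BLeft 0) (BSide e (pinv f y))] : set R) = (pinv f y)%:E.
    rewrite /leb lebesgue_measure_itv /= lte_fin sube0.
    by case: ltgtP (pinv_ge0 f y) => // <-.
  apply/eqP; rewrite eq_le; apply/andP; split.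
    rewrite -(leb0 true) /leb; apply: le_measure; rewrite ?inE//.
    move=> x /=; rewrite in_itv /= => /andP[x0 xp].
    have x1 : x <= 1 by apply: ltW; apply: lt_le_trans xp _; exact: pinv_le1.
    rewrite /ysection /= inE; split; last exact: le_of_lt_pinv xp.
    by split; [rewrite /= in_itv /= x0 x1|exact: set_mem y01].
  rewrite -(leb0 false) /leb; apply: le_measure; rewrite ?inE//.
  move=> x; rewrite /ysection /= inE => -[[/= x01 _] /= yfx].
  by move: x01; rewrite !in_itv /= => x01; rewrite pinv_ge//; case/andP: x01 => ->.
transitivity (\int[@leb R]_x (leb (xsection A x)))%E; first exact/esym.
apply: eq_integral => x _ /=; rewrite patchE; case: ifPn => x01; last first.
  suff -> : xsection A x = set0 by rewrite /leb measure0.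
  rewrite -subset0 => y.
  rewrite /xsection /= inE => -[[/= x01' _] _].
  by move/negP: x01; apply; rewrite inE.
have /andP[x0 x1] : 0 <= x <= 1 by move: x01; rewrite inE /= in_itv.
have fx0 : 0 <= f x by apply: le_trans f1 _; exact: nf.
have fx1 : f x <= 1 by apply: le_trans f0; exact: nf.
have -> : xsection A x = `[0, f x]%classic.
  apply/seteqP; split => y; rewrite /xsection /= !in_itv /=.
    by rewrite inE => -[[_ /=]]; rewrite in_itv /= => /andP[-> _] ->.
  move=> /andP[y0 yf]; rewrite inE; split => //; split.
    exact: set_mem x01.
  by rewrite /= in_itv /= y0 (le_trans yf).
rewrite /leb lebesgue_measure_itv /= lte_fin sube0.
by case: ltgtP fx0 => // <-.
Qed.

End PseudoInverse.

(** * The operator on decreasing profiles *)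

Section Operator.
Context {R : realType}.
Implicit Types (f g : R -> R) (a b s t x y : R).

(** Monotone on the whole line, which spares side conditions; the values are bounded below only up
    to 1. *)
Definition profile f :=
  [/\ nonincreasing_fun f, f 0 = 1, 0 <= f 1 & 0 < itvint f 0 1].

Lemma profile_ge0 f x : profile f -> x <= 1 -> 0 <= f x.
Proof. by case=> nf _ f1 _ x1; apply: le_trans f1 _; exact: nf. Qed.

Lemma profile_le1 f x : profile f -> 0 <= x -> f x <= 1.
Proof. by case=> nf <- _ _ x0; exact: nf. Qed.

Lemma profile_int_le1 f : profile f -> itvint f 0 1 <= 1.
Proof.
move=> [nf f0 f1 _]; apply: le_trans (itvint_upper nf ler01) _.
by rewrite f0; lra.
Qed.

Lemma profile_itvint_pinv f : profile f ->
  itvint (pinv f) 0 1 = itvint f 0 1.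
Proof. by case=> nf f0 f1 _; apply: itvint_pinv => //; rewrite f0. Qed.

Lemma Tmap_ext f g : (forall x, x \in @unit_itv R -> f x = g x) ->
  Tmap f = Tmap g.
Proof.
move=> fg; have pfg : pinv f = pinv g.
  apply/funext => y; rewrite /Defs.pinv; congr sup; apply/seteqP.
  by split=> x /= [x01]; rewrite fg.
apply/funext => x; rewrite /Tmap pfg; congr (_ / _).
exact: eq_Rintegral.
Qed.

Lemma Tmap_eq0 f x : 1 <= x -> Tmap f x = 0.
Proof.
rewrite le_eqVlt => /predU1P[<-|x1]; last first.
  by rewrite /Tmap -/(itvint _ _ _) itvint_empty// mul0r.
by rewrite /Tmap set_itv1 Rintegral_set1 mul0r.
Qed.

Lemma Tmap_ge0 f x : profile f -> 0 <= Tmap f x.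
Proof.
case=> _ _ _ F0; apply: divr_ge0; last exact: ltW.
by apply: itvint_ge0 => y _; exact: pinv_ge0.
Qed.

Lemma Tmap_increment f s t : s <= t -> t <= 1 ->
  Tmap f s - Tmap f t = itvint (pinv f) s t / itvint f 0 1.
Proof.
move=> st t1; rewrite /Tmap -!/(itvint _ _ _) -mulrBl.
by rewrite (itvint_cat (pinv_nonincreasing f) st t1) addrK.
Qed.

Lemma Tmap_nonincreasing f : profile f -> nonincreasing_fun (Tmap f).
Proof.
move=> pf s t st; have [t1|/ltW t1] := leP t 1; last first.
  by rewrite (Tmap_eq0 f t1) Tmap_ge0.
rewrite -subr_ge0 Tmap_increment//; case: pf => _ _ _ F0.
by rewrite divr_ge0 ?(ltW F0)//; apply: itvint_ge0 => y _; exact: pinv_ge0.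
Qed.

(** The integrand [pinv f] is at most 1. *)
Lemma Tmap_lipschitz f s t : profile f -> s <= t -> t <= 1 ->
  Tmap f s - Tmap f t <= (itvint f 0 1)^-1 * (t - s).
Proof.
move=> pf st t1; rewrite Tmap_increment// mulrC; case: pf => _ _ _ F0.
rewrite ler_pM2l ?invr_gt0//.
apply: le_trans (itvint_upper (pinv_nonincreasing f) st) _.
by rewrite ler_piMl ?subr_ge0// pinv_le1.
Qed.

Lemma Tmap0 f : profile f -> Tmap f 0 = 1.
Proof.
move=> pf; rewrite /Tmap -!/(itvint _ _ _) profile_itvint_pinv//.
by rewrite divff//; case: pf => _ _ _ /gt_eqF ->.
Qed.

Lemma Tmap_lower f x : profile f -> 0 <= x <= 1 ->
  1 - (itvint f 0 1)^-1 * x <= Tmap f x.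
Proof.
move=> pf /andP[x0 x1]; have := Tmap_lipschitz pf x0 x1.
by rewrite Tmap0// subr0; lra.
Qed.

Lemma Tmap_profile f : profile f -> profile (Tmap f).
Proof.
move=> pf; have nT := Tmap_nonincreasing pf; have F1 := profile_int_le1 pf.
have [_ _ _ F0] := pf.
split; [exact: nT|exact: Tmap0|exact: Tmap_ge0|].
set F := itvint f 0 1 in F0 F1.
have x1 : F / 2 <= 1 by lra.
have x0 : 0 <= F / 2 by lra.
rewrite (itvint_cat nT x0 x1).
have I1 : 0 <= itvint (Tmap f) (F / 2) 1.
  by apply: itvint_ge0 => y _; exact: Tmap_ge0.
have I0 := itvint_lower nT x0.
have T2 : 1 / 2 <= Tmap f (F / 2).
  have := @Tmap_lower f (F / 2) pf; rewrite -/F x0 x1 => /(_ isT).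
  by rewrite mulrA mulVf ?gt_eqF//; lra.
by nra.
Qed.

Lemma h0_profile : profile (@h0 R).
Proof.
split; rewrite /h0 ?ler01//.
by rewrite itvint_cst// subr0 mulr1.
Qed.

Lemma iter_Tmap_profile n f : profile f -> profile (iter n (@Tmap R) f).
Proof. by move=> pf; elim: n => [|n IH] //=; exact: Tmap_profile. Qed.

(** Right continuity at 0 of a profile, in the form that makes [pinv f y] positive for [y < 1],
    hence [Tmap f] positive before 1. *)
Definition cont0 f := forall y, y < 1 -> exists2 x, 0 < x <= 1 & y <= f x.

Lemma h0_cont0 : cont0 (@h0 R).
Proof. by move=> y /ltW y1; exists 1; rewrite ?ltr01 ?lexx. Qed.

Lemma Tmap_cont0 f : profile f -> cont0 (Tmap f).
Proof.
move=> pf y y1; have F1 := profile_int_le1 pf; have [_ _ _ F0] := pf.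
have [y0|y0] := leP y 0.
  by exists 1; [rewrite ltr01 lexx|rewrite (le_trans y0)// Tmap_ge0].
set F := itvint f 0 1 in F0 F1.
(* The abscissa where the bound [1 - x / F] of [Tmap_lower] equals [y]. *)
have x0 : 0 < F * (1 - y) by rewrite mulr_gt0// subr_gt0.
have x1 : F * (1 - y) <= 1 by nra.
exists (F * (1 - y)); first by rewrite x0.
have := @Tmap_lower f (F * (1 - y)) pf; rewrite (ltW x0) x1 => /(_ isT).
by rewrite -/F mulrA mulVf ?gt_eqF//; lra.
Qed.

Lemma Tmap_gt0 f x : profile f -> cont0 f -> x < 1 -> 0 < Tmap f x.
Proof.
move=> pf cf x1; have [nf _ _ F0] := pf; apply: divr_gt0 => //.
apply: itvint_gt0 => //; [exact: pinv_nonincreasing|exact: pinv_ge0|].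
move=> y y1; have [z /andP[z0 z1] yz] := cf _ y1.
by apply: (lt_le_trans z0); apply: pinv_ge => //; rewrite (ltW z0).
Qed.

(** [pinv f] vanishes above the height [f 0 = 1], so the upper limit can be raised to a bound [M]
    shared with a rescaled function. *)
Lemma itvint_pinv_tail f x M : profile f -> x <= M -> 1 <= M ->
  itvint (pinv f) x 1 = itvint (pinv f) x M.
Proof.
move=> [nf f0 _ _] xM M1; have np := pinv_nonincreasing f.
have z s : 1 <= s -> itvint (pinv f) s M = 0.
  move=> s1; apply/eqP; rewrite eq_le; apply/andP; split; last first.
    by apply: itvint_ge0 => y _; exact: pinv_ge0.
  have [sM|Ms] := leP s M; last by rewrite itvint_empty.
  rewrite -[X in _ <= X](mul0r (M - s)) -itvint_cst//; apply: le_itvint => //.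
  move=> y /andP[sy _]; rewrite pinv_eq0// f0; exact: le_lt_trans sy.
have [x1|x1] := leP x 1.
  by rewrite (itvint_cat np x1 M1) z// addr0.
by rewrite z ?itvint_empty// ltW.
Qed.

Lemma TmapE f x M : profile f -> x <= M -> 1 <= M ->
  Tmap f x = itvint (pinv f) x M / itvint f 0 1.
Proof. by move=> pf xM M1; rewrite /Tmap -(itvint_pinv_tail pf xM M1). Qed.

Lemma Tmap_scale g a x M : profile g -> 0 < a -> x <= M -> a <= M ->
  Tmap g (x / a) =
  itvint (fun y => pinv g (y / a)) x M / (a * itvint g 0 1).
Proof.
move=> pg a0 xM aM.
rewrite (@TmapE g _ (M / a))//; first last.
- by rewrite ler_pdivlMr// mul1r.
- by rewrite ler_pM2r// invr_gt0.
rewrite itvint_scale//; [|exact: pinv_nonincreasing|exact: pinv_ge0].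
by rewrite invfM mulrACA mulfV ?gt_eqF// mul1r.
Qed.

End Operator.

(** * Sign changes *)

Section Crossing.
Context {R : realType}.
Implicit Types (f g h u v : R -> R) (a b s t x y : R) (D : set R).

(* Excludes the sign pattern [- + -] for [u] minus a scaled copy of [v]. *)
Definition crossing_free D u v := forall a b, 0 < a -> 0 < b ->
  forall y1 y2 y3, D y1 -> y1 < y2 -> y2 < y3 ->
  u y1 < b * v (y1 / a) -> b * v (y2 / a) < u y2 -> b * v (y3 / a) <= u y3.

Lemma pinv_h0_crossing_free f D : crossing_free D (pinv f) (pinv (@h0 R)).
Proof.
move=> a b a0 b0 y1 y2 y3 _ y12 y23 lt1 gt2.
(* [pinv h0] is again a box. Past [a] it is 0; up to [a] a constant is compared with a decreasing
   function. *)
have h1 y : y <= 1 -> pinv (@h0 R) y = 1.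
  move=> y1'; apply/eqP; rewrite eq_le pinv_le1.
  by apply: pinv_ge; rewrite ?ler01 ?lexx.
have [y31|y31] := leP (y3 / a) 1; last first.
  rewrite (pinv_eq0 (f := @h0 R)) ?mulr0 ?pinv_ge0//.
have y21 : y2 / a <= 1.
  by apply: le_trans y31; rewrite ler_pM2r ?invr_gt0// ltW.
have := pinv_nonincreasing f (ltW y12).
move: gt2; rewrite h1// mulr1 => gt2 le12.
have : b * pinv (@h0 R) (y1 / a) <= b by rewrite ger_pMr// pinv_le1.
by lra.
Qed.

(* Tails of an integral change sign at most as often as the integrand. *)
Lemma Tmap_crossing_free f g : profile f -> profile g ->
  crossing_free [set y | 0 < y] (pinv f) (pinv g) ->
  crossing_free [set x | 0 <= x] (Tmap f) (Tmap g).
Proof.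
move=> pf pg cf a b a0 b0 x1 x2 x3 /= x10 x12 x23 lt1 gt2.
rewrite leNgt; apply/negP => lt3.
have [_ _ _ F0] := pf; have [_ _ _ G0] := pg.
pose M := Num.max (Num.max 1 a) x3.
have M1 : 1 <= M by rewrite /M !le_max lexx.
have Ma : a <= M by rewrite /M !le_max lexx orbT.
have x3M : x3 <= M by rewrite /M le_max lexx orbT.
have x2M : x2 <= M by exact: le_trans (ltW x23) x3M.
have x1M : x1 <= M by exact: le_trans (ltW x12) x2M.
(* Chosen so that [b * Tmap g (x / a)] is a tail of [q] over the same denominator as [Tmap f x]. *)
pose K := b * itvint f 0 1 / (a * itvint g 0 1).
have K0 : 0 < K by rewrite /K divr_gt0 ?mulr_gt0.
pose p := pinv f; pose q y := K * pinv g (y / a).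
have np : nonincreasing_fun p by exact: pinv_nonincreasing.
have nga := nonincreasing_comp_div a0 (pinv_nonincreasing g).
have nq : nonincreasing_fun q by move=> y z yz; rewrite ler_pM2l// nga.
have TfE x : x <= M -> Tmap f x = itvint p x M / itvint f 0 1.
  by move=> xM; exact: TmapE.
have TgE x : x <= M -> b * Tmap g (x / a) = itvint q x M / itvint f 0 1.
  move=> xM; rewrite (Tmap_scale pg a0 xM Ma) /q itvintZ// /K.
  by field; rewrite !gt_eqF.
have lt x : x <= M -> (Tmap f x < b * Tmap g (x / a)) =
    (itvint p x M < itvint q x M).
  by move=> xM; rewrite TfE// TgE// ltr_pM2r// invr_gt0.
have gt x : x <= M -> (b * Tmap g (x / a) < Tmap f x) =
    (itvint q x M < itvint p x M).
  by move=> xM; rewrite TfE// TgE// ltr_pM2r// invr_gt0.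
rewrite lt// in lt1; rewrite gt// in gt2; rewrite lt// in lt3.
(* The tails of [p - q] have signs - + - at [x1], [x2], [x3]; their two increments and the last tail
   yield points [y1 < y2 < y3] where [p - q] has signs - + -. *)
have [y3 /andP[x3y3 _] l3] := itvint_witness np nq lt3.
have [y2 /andP[x2y2 y2x3] l2] : exists2 y, x2 < y <= x3 & q y < p y.
  apply: itvint_witness => //.
  have := itvint_cat np (ltW x23) x3M; have := itvint_cat nq (ltW x23) x3M.
  by lra.
have [y1 /andP[x1y1 y1x2] l1] : exists2 y, x1 < y <= x2 & p y < q y.
  apply: itvint_witness => //.
  have := itvint_cat np (ltW x12) x2M; have := itvint_cat nq (ltW x12) x2M.
  by lra.
have : q y3 <= p y3.
  apply: (cf a K a0 K0 y1 y2 y3) => //=.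
  - exact: le_lt_trans x1y1.
  - exact: le_lt_trans x2y2.
  - exact: le_lt_trans x3y3.
by rewrite leNgt l3.
Qed.

(** After rescaling, [t] may lie beyond 1, out of reach of [lt_of_pinv_lt]. *)
Lemma lt_of_pinv_lt_vanish f t y : (forall x, 1 <= x -> f x = 0) ->
  0 <= t -> 0 < y -> pinv f y < t -> f t < y.
Proof.
move=> f1 t0 y0 pt; have [t1|/ltW t1] := leP t 1; last by rewrite f1.
by apply: lt_of_pinv_lt => //; rewrite t0.
Qed.

(* Reflecting the two graphs in the diagonal reverses the order of the
   crossings and exchanges the two scalings. *)
Lemma pinv_crossing_free u v :
  nonincreasing_fun u -> nonincreasing_fun v ->
  (forall x, 1 <= x -> u x = 0) -> (forall x, 1 <= x -> v x = 0) ->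
  crossing_free [set x | 0 <= x] u v ->
  crossing_free [set y | 0 < y] (pinv u) (pinv v).
Proof.
move=> nu nv u1 v1 cf a b a0 b0 y1 y2 y3 /= y10 y12 y23 lt1 gt2.
rewrite leNgt; apply/negP => lt3.
have y20 := lt_trans y10 y12; have y30 := lt_trans y20 y23.
(* A midpoint between the two pseudo-inverses turns a comparison at height [y] into one of the
   graphs at abscissa [t]. *)
have below y : 0 < y -> pinv u y < b * pinv v (y / a) ->
    exists2 t, 0 <= t & u t < y <= a * v (t / b).
  move=> y0 ltp; pose t := (pinv u y + b * pinv v (y / a)) / 2.
  have ut : pinv u y < t by rewrite /t; lra.
  have vt : t < b * pinv v (y / a) by rewrite /t; lra.
  have t0 : 0 <= t by apply: ltW; apply: le_lt_trans ut; exact: pinv_ge0.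
  exists t => //; rewrite lt_of_pinv_lt_vanish//=.
  rewrite mulrC -ler_pdivrMr//; apply: le_of_lt_pinv => //.
    by rewrite divr_ge0// ltW.
  by rewrite ltr_pdivrMr// mulrC.
have [t1 t10 /andP[ut1 vt1]] := below _ y10 lt1.
have [t3 t30 /andP[ut3 vt3]] := below _ y30 lt3.
pose t2 := (pinv u y2 + b * pinv v (y2 / a)) / 2.
have ut2' : t2 < pinv u y2 by rewrite /t2; lra.
have vt2' : b * pinv v (y2 / a) < t2 by rewrite /t2; lra.
have t20 : 0 <= t2.
  apply: ltW; apply: le_lt_trans vt2'.
  by rewrite mulr_ge0 ?pinv_ge0// ltW.
have ut2 : y2 <= u t2 by exact: le_of_lt_pinv.
have vt2 : a * v (t2 / b) < y2.
  rewrite mulrC -ltr_pdivlMr//; apply: lt_of_pinv_lt_vanish => //.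
  - by rewrite divr_ge0// ltW.
  - by rewrite divr_gt0.
  - by rewrite ltr_pdivlMr// mulrC.
have t21 : t2 < t1.
  rewrite ltNge; apply/negP => t12; have := nu _ _ t12.
  by lra.
have t32 : t3 < t2.
  rewrite ltNge; apply/negP => t23.
  have vv : v (t3 / b) <= v (t2 / b) by apply: nv; rewrite ler_pM2r// invr_gt0.
  have : a * v (t3 / b) <= a * v (t2 / b) by rewrite ler_pM2l.
  by lra.
have := cf b a b0 a0 t3 t2 t1 t30 t32 t21.
have l3 : u t3 < a * v (t3 / b) by lra.
have l2 : a * v (t2 / b) < u t2 by lra.
by move=> /(_ l3 l2); lra.
Qed.

(** Each step takes tails and then reflects; the start is the comparison with a box. *)
Lemma iter_Tmap_crossing_free n f : profile f ->
  crossing_free [set y | 0 < y] (pinv (iter n (@Tmap R) f)) (pinv (@hseq R n)).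
Proof.
move=> pf; elim: n => [|n IH]; first exact: pinv_h0_crossing_free.
have p1 := iter_Tmap_profile n pf; have p2 := iter_Tmap_profile n (@h0_profile R).
rewrite /hseq /=; apply: pinv_crossing_free.
- exact: Tmap_nonincreasing.
- exact: Tmap_nonincreasing.
- exact: Tmap_eq0.
- exact: Tmap_eq0.
- exact: Tmap_crossing_free.
Qed.

(** * Decreasing ratios *)

(** Cross-multiplied because [v] may vanish at 1. *)
Definition ratio_nonincreasing u v := forall x y, 0 <= x -> x <= y -> y <= 1 ->
  u y * v x <= u x * v y.

(* A violation [u x < al * v x], [al * v y < u y] would survive stretching
   [v] slightly, but then [v] outlives [u] and there is a third crossing. *)
Lemma crossing_free_ratio u v L :
  crossing_free [set x | 0 <= x] u v ->
  (forall x, 0 <= x -> 0 <= u x) -> (forall x, 1 <= x -> u x = 0) ->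
  nonincreasing_fun v -> 0 <= v 1 -> (forall x, x < 1 -> 0 < v x) ->
  0 < L -> (forall s t, s <= t -> t <= 1 -> v s - v t <= L * (t - s)) ->
  ratio_nonincreasing u v.
Proof.
move=> cf u0 u1 nv v1 v0 L0 lip x y x0; rewrite le_eqVlt => /predU1P[->//|xy].
rewrite le_eqVlt => /predU1P[->|y1].
  by rewrite u1// mul0r mulr_ge0// u0.
have vx := v0 _ (lt_trans xy y1); have vy := v0 _ y1.
have ux := u0 _ x0.
rewrite leNgt; apply/negP => viol.
have viol' : u x / v x < u y / v y by rewrite ltr_pdivrMr// mulrAC ltr_pdivlMr.
pose al := (u x / v x + u y / v y) / 2.
have al1 : u x < al * v x by rewrite -ltr_pdivrMr// /al; lra.
have al2 : al * v y < u y by rewrite -ltr_pdivlMr// /al; lra.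
have al0 : 0 < al by have : 0 <= u x / v x by [rewrite divr_ge0// ltW]; rewrite /al; lra.
have y0 : 0 <= y by exact: ltW (le_lt_trans x0 xy).
(* Stretching by [1 + e] raises [al * v] at [y] by at most half the gap [u y - al * v y]. *)
pose e := (u y - al * v y) / (2 * (al * L)).
have al2L : 0 < 2 * (al * L) by have := mulr_gt0 al0 L0; lra.
have e0 : 0 < e by rewrite /e; apply: divr_gt0 => //; rewrite subr_gt0.
have eE : al * L * e = (u y - al * v y) / 2.
  by rewrite /e; field; rewrite !gt_eqF.
have b0 : 0 < 1 + e by lra.
have div_le z : 0 <= z -> z / (1 + e) <= z.
  by move=> z0; rewrite ler_pdivrMr// ler_peMr//; lra.
have ydiff : y - y / (1 + e) <= e.
  rewrite lerBlDr -lerBlDl ler_pdivlMr//; nra.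
(* The third point lies past 1, where [u] vanishes, but before the end [1 + e] of the stretched
   [v]. *)
have := cf (1 + e) al b0 al0 x y (1 + e / 2) x0 xy.
have z1 : y < 1 + e / 2 by lra.
move=> /(_ z1); have l1 : u x < al * v (x / (1 + e)).
  apply: lt_le_trans al1 _; rewrite ler_pM2l//; apply: nv; exact: div_le.
have l2 : al * v (y / (1 + e)) < u y.
  have := lip _ _ (div_le _ y0) (ltW y1).
  by nra.
move=> /(_ l1 l2); rewrite u1; last by lra.
rewrite leNgt => /negP; apply; rewrite mulr_gt0//; apply: v0.
by rewrite ltr_pdivrMr//; lra.
Qed.

Lemma hseq_profile n : profile (@hseq R n).
Proof. exact: iter_Tmap_profile (@h0_profile R). Qed.

Lemma hseq_cont0 n : cont0 (@hseq R n).
Proof.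
case: n => [|n]; first exact: h0_cont0.
exact: Tmap_cont0 (hseq_profile n).
Qed.

(** The index starts at 1: the last application of [Tmap] supplies the vanishing at 1, the
    positivity and the Lipschitz bound for [crossing_free_ratio]. *)
Lemma iter_Tmap_ratio n f : profile f ->
  ratio_nonincreasing (iter n.+1 (@Tmap R) f) (@hseq R n.+1).
Proof.
move=> pf; have p1 := iter_Tmap_profile n pf; have p2 := hseq_profile n.
have [_ _ _ H0] := p2.
change (ratio_nonincreasing (Tmap (iter n (@Tmap R) f)) (Tmap (@hseq R n))).
apply: (crossing_free_ratio (L := (itvint (@hseq R n) 0 1)^-1)).
- by apply: Tmap_crossing_free => //; exact: iter_Tmap_crossing_free.
- by move=> x _; exact: Tmap_ge0.
- exact: Tmap_eq0.
- exact: Tmap_nonincreasing.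
- exact: Tmap_ge0.
- by move=> x; exact: (Tmap_gt0 p2 (@hseq_cont0 n)).
- by rewrite invr_gt0.
- by move=> s t; exact: Tmap_lipschitz.
Qed.

(** The ratio starts at 1 and decreases. *)
Lemma ratio_le u v : profile u -> profile v -> ratio_nonincreasing u v ->
  forall x, 0 <= x <= 1 -> u x <= v x.
Proof.
move=> [_ u0 _ _] [_ v0 _ _] r x /andP[x0 x1].
by have := r _ _ (lexx 0) x0 x1; rewrite u0 v0 mulr1 mul1r.
Qed.

(* After rescaling [h] to the height [a] at which its integral is that of [f],
   the graphs cross once, so the tails of [f^*] dominate. *)
Lemma ratio_Tmap_ge f h x : profile f -> profile h ->
  ratio_nonincreasing f h -> 0 <= x ->
  Tmap h (x / (itvint f 0 1 / itvint h 0 1)) <= Tmap f x.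
Proof.
move=> pf ph r x0.
have [nf _ _ F0] := pf; have [nh _ _ H0] := ph.
set a := itvint f 0 1 / itvint h 0 1; have a0 : 0 < a by exact: divr_gt0.
pose M := Num.max (Num.max 1 a) x.
have M1 : 1 <= M by rewrite /M !le_max lexx.
have Ma : a <= M by rewrite /M !le_max lexx orbT.
have xM : x <= M by rewrite /M le_max lexx orbT.
have M0 : 0 <= M by exact: le_trans M1.
pose p := pinv f; pose q y := pinv h (y / a).
have np : nonincreasing_fun p by exact: pinv_nonincreasing.
have nq := nonincreasing_comp_div a0 (pinv_nonincreasing h).
have aH : a * itvint h 0 1 = itvint f 0 1 by rewrite divfK// gt_eqF.
rewrite (TmapE pf xM M1) (Tmap_scale ph a0 xM Ma) aH.
rewrite ler_pM2r ?invr_gt0// leNgt; apply/negP => lt2.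
(* By the choice of [a] the total integrals agree, so a deficit past [x] forces an excess before
   it. *)
have eq0 : itvint p 0 M = itvint q 0 M.
  rewrite -(itvint_pinv_tail pf M0 M1) profile_itvint_pinv//.
  have := Tmap0 ph; rewrite -{1}(mul0r a^-1) (Tmap_scale ph a0 M0 Ma) aH.
  move=> /(congr1 (fun z => z * itvint f 0 1)).
  by rewrite mul1r divfK ?gt_eqF.
have [y2 /andP[xy2 _] l2] := itvint_witness np nq lt2.
have [y1 /andP[y10 y1x] l1] : exists2 y, 0 < y <= x & q y < p y.
  apply: itvint_witness => //.
  have := itvint_cat np x0 xM; have := itvint_cat nq x0 xM.
  by move: eq0 lt2; rewrite -/p -/q; lra.
have y20 : 0 < y2 by exact: le_lt_trans xy2.
have y12 : y1 < y2 by exact: le_lt_trans xy2.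
(* Midpoints transfer both inequalities to the graphs: [f > a * h] at [t1] and [f < a * h] at
   [t2 < t1], against the decreasing ratio. *)
pose t1 := (q y1 + p y1) / 2; pose t2 := (q y2 + p y2) / 2.
have q0 y : 0 <= q y <= 1 by rewrite pinv_ge0 pinv_le1.
have p0 y : 0 <= p y <= 1 by rewrite pinv_ge0 pinv_le1.
have := q0 y1; have := q0 y2; have := p0 y1; have := p0 y2.
move=> /andP[p20 p21] /andP[p10 p11] /andP[q20 q21] /andP[q10 q11].
have t10 : 0 <= t1 by rewrite /t1; lra.
have t11 : t1 <= 1 by rewrite /t1; lra.
have t20 : 0 <= t2 by rewrite /t2; lra.
have t21 : t2 <= 1 by rewrite /t2; lra.
have t1p : t1 < p y1 by rewrite /t1; lra.
have qt1 : q y1 < t1 by rewrite /t1; lra.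
have t2q : t2 < q y2 by rewrite /t2; move: l2; rewrite -/(q y2); lra.
have pt2 : p y2 < t2 by rewrite /t2; move: l2; rewrite -/(q y2); lra.
have ft1 : y1 <= f t1 by exact: le_of_lt_pinv t1p.
have ht2 : y2 / a <= h t2 by exact: le_of_lt_pinv t2q.
have ft2 : f t2 < y2 by apply: lt_of_pinv_lt pt2; rewrite t20.
have ht1 : h t1 < y1 / a by apply: lt_of_pinv_lt qt1; rewrite t10.
have ya : y1 / a < y2 / a by rewrite ltr_pM2r// invr_gt0.
have t12 : t2 < t1.
  rewrite ltNge; apply/negP => t12; have := nh _ _ t12; lra.
have := r _ _ t20 (ltW t12) t11.
have h10 : 0 <= h t1 by exact: profile_ge0.
have E1 : a * (y1 / a) = y1 by rewrite mulrC divfK// gt_eqF.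
have E2 : a * (y2 / a) = y2 by rewrite mulrC divfK// gt_eqF.
have A1 : a * h t1 < f t1 by apply: lt_le_trans ft1; rewrite -E1 ltr_pM2l.
have A2 : f t2 < a * h t2 by apply: lt_le_trans ft2 _; rewrite -E2 ler_pM2l.
have h20 : 0 < h t2 by apply: lt_le_trans ht2; exact: divr_gt0.
have B1 : a * h t1 * h t2 < f t1 * h t2 by rewrite ltr_pM2r.
have B2 : f t2 * h t1 <= a * h t2 * h t1 by rewrite ler_wpM2r// ltW.
by move: B1 B2; rewrite [a * h t2 * _]mulrAC; lra.
Qed.

(** [ratio_Tmap_ge] integrated over [[0, a]], where the rescaled copy of [Tmap h] lives; the rest of
    [Tmap f] is a surplus. *)
Lemma ratio_int_ge f h a : profile f -> profile h ->
  ratio_nonincreasing f h ->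
  a = itvint f 0 1 / itvint h 0 1 ->
  a * itvint (Tmap h) 0 1 + itvint (Tmap f) a 1 <= itvint (Tmap f) 0 1.
Proof.
move=> pf ph r aE.
have [nf _ _ F0] := pf; have [nh _ _ H0] := ph.
have a0 : 0 < a by rewrite aE; exact: divr_gt0.
have a1 : a <= 1.
  rewrite aE ler_pdivrMr// mul1r; apply: le_itvint => // x /andP[/ltW x0 x1].
  by apply: ratio_le => //; rewrite x0.
have nT := Tmap_nonincreasing pf; have nTh := Tmap_nonincreasing ph.
rewrite (itvint_cat nT (ltW a0) a1) lerD2r.
rewrite -[X in itvint (Tmap h) X](mul0r a^-1).
rewrite -[X in itvint (Tmap h) _ X](@mulfV _ a) ?gt_eqF//.
rewrite -itvint_scale//; last by move=> x; exact: Tmap_ge0.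
apply: le_itvint => //; first exact: nonincreasing_comp_div.
by move=> x /andP[/ltW x0 _]; rewrite aE; exact: ratio_Tmap_ge.
Qed.

End Crossing.

(** * Periodic points *)

Section Periodic.
Context {R : realType}.
Implicit Types (f g : R -> R) (a b s t x y : R).

(** [hseq n.+2] is an iterate of order [n.+1], applied to [Tmap h0], so its ratio to [hseq n.+1]
    decreases. *)
Lemma hseq_nonincreasing x : 0 <= x <= 1 ->
  nonincreasing_seq (fun n => @hseq R n x).
Proof.
move=> x01; apply/nonincreasing_seqP => -[|n].
  by apply: profile_le1 (hseq_profile 1) _; case/andP: x01.
have -> : @hseq R n.+2 = iter n.+1 (@Tmap R) (Tmap (@h0 R)).
  by rewrite /hseq iterSr.
have pT := Tmap_profile (@h0_profile R).
apply: ratio_le x01; [exact: iter_Tmap_profile|exact: hseq_profile|].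
exact: iter_Tmap_ratio.
Qed.

Lemma itvint_hseq_nonincreasing :
  nonincreasing_seq (fun n => itvint (@hseq R n) 0 1).
Proof.
move=> m n mn; have [n1 _ _ _] := @hseq_profile R m; have [n2 _ _ _] := @hseq_profile R n.
apply: le_itvint => // x /andP[/ltW x0 x1].
by apply: (hseq_nonincreasing (x := x)) mn; rewrite x0.
Qed.

(** The bound is asked from index 1 on, where the ratios to [hseq] are available; monotonicity
    covers index 0. *)
Lemma nonincreasing_limn_ge (u : R^nat) l : nonincreasing_seq u ->
  (forall n, l <= u n.+1) ->
  (forall n, limn u <= u n) /\ l <= limn u.
Proof.
move=> nu lu; have lb : forall n, l <= u n.
  by case=> [|n] //; apply: le_trans (lu 0%N) _; exact: nu.
have cu : cvgn u.
  by apply: nonincreasing_is_cvgn => //; exists l => _ [n _ <-].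
split; first by move=> n; exact: nonincreasing_cvgn_ge.
by apply: limr_ge => //; exact: nearW.
Qed.

(** * A periodic orbit and the integrals along it *)

Section Cycle.
Variables (r : nat) (G : R -> R).
Hypotheses (r0 : (0 < r)%N) (pG : profile G) (perG : iter r (@Tmap R) G = G).

Let g k := iter k (@Tmap R) G.
Let c k := itvint (g k) 0 1.
Let H := limn (fun n => itvint (@hseq R n) 0 1).

Let g_profile k : profile (g k). Proof. exact: iter_Tmap_profile. Qed.

Let g_ratio k n : ratio_nonincreasing (g k) (@hseq R n.+1).
Proof.
have per m : iter (m * r) (@Tmap R) G = G.
  by elim: m => [|m IH] //; rewrite mulSn iterD IH perG.
(* Go back [n.+1] steps after [n.+1] full turns; [r > 0] makes the subtraction exact. *)
have -> : g k = iter n.+1 (@Tmap R) (g (k + n.+1 * r - n.+1)).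
  rewrite -iterD subnKC; last by rewrite (leq_trans _ (leq_addl _ _))// leq_pmulr.
  by rewrite iterD per.
exact: iter_Tmap_ratio.
Qed.

Let g_Tmap k : g k = Tmap (g (k + r).-1).
Proof.
rewrite -[RHS]/(iter (k + r).-1.+1 (@Tmap R) G) prednK ?addn_gt0 ?r0 ?orbT//.
by rewrite iterD perG.
Qed.

Let g_eq0 k x : 1 <= x -> g k x = 0.
Proof. by rewrite g_Tmap; exact: Tmap_eq0. Qed.

Let g_gt0 k x : x < 1 -> 0 < g k x.
Proof.
move=> x1; rewrite g_Tmap; apply: Tmap_gt0 => //.
by rewrite g_Tmap; exact: Tmap_cont0.
Qed.

Let c_le k n : c k <= itvint (@hseq R n.+1) 0 1.
Proof.
have [ng _ _ _] := g_profile k; have [nh _ _ _] := @hseq_profile R n.+1.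
apply: le_itvint => // x /andP[/ltW x0 x1].
by apply: ratio_le => //; [exact: hseq_profile|rewrite x0].
Qed.

Let c_le_H k : c k <= H.
Proof. by case: (nonincreasing_limn_ge itvint_hseq_nonincreasing (c_le k)). Qed.

Let H_le n : H <= itvint (@hseq R n) 0 1.
Proof. by case: (nonincreasing_limn_ge itvint_hseq_nonincreasing (c_le 0)). Qed.

Let c_gt0 k : 0 < c k. Proof. by case: (g_profile k). Qed.

Let H_gt0 : 0 < H. Proof. exact: lt_le_trans (c_gt0 0) (c_le_H 0). Qed.

(** [ratio_int_ge] for [g k] and [hseq n.+1], whose integral [C] is at least [H]: the surplus past
    [c k / C] contains the one past [c k / H]. Then [C] tends to [H]. *)
Let c_step k : c k + itvint (g k.+1) (c k / H) 1 <= c k.+1.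
Proof.
have aux (X J I Y Z : R) : Z <= X -> 0 <= J -> X + (J + I) <= Y -> Z <= Y - I.
  by move=> *; lra.
set I := itvint _ (c k / H) _.
have [ng _ g1 _] := g_profile k.+1; have c0 := c_gt0 k.
have ge n : c k * H / itvint (@hseq R n.+1) 0 1 <= c k.+1 - I.
  set C := itvint (@hseq R n.+1) 0 1; have HC : H <= C by exact: H_le.
  have C0 : 0 < C by exact: lt_le_trans HC.
  have aa : c k / C <= c k / H by rewrite ler_pM2l// lef_pV2.
  have a1 : c k / H <= 1 by rewrite ler_pdivrMr// mul1r.
  have := @ratio_int_ge R (g k) (@hseq R n.+1) (c k / C) (g_profile k)
    (hseq_profile n.+1) (@g_ratio k n) erefl.
  have -> : Tmap (g k) = g k.+1 by [].
  rewrite -[Tmap (hseq n.+1)]/(@hseq R n.+2).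
  rewrite -/(c k.+1) (itvint_cat ng aa a1) -/I.
  have J0 : 0 <= itvint (g k.+1) (c k / C) (c k / H).
    apply: itvint_ge0 => y /andP[_ y1].
    by apply: profile_ge0 => //; exact: le_trans a1.
  have hH : c k * H / C <= c k / C * itvint (@hseq R n.+2) 0 1.
    rewrite mulrAC; apply: ler_wpM2l; last exact: H_le.
    by apply/ltW/divr_gt0; [exact: c0|exact: C0].
  exact: (aux _ _ _ _ _ hH J0).
have C0 n : 0 < itvint (@hseq R n.+1) 0 1 by exact: lt_le_trans (H_le n.+1).
have d0 : 0 < c k.+1 - I.
  by apply: lt_le_trans (ge 0%N); rewrite divr_gt0// mulr_gt0.
(* Solved for [C], the inequality is a lower bound uniform in [n] and passes to the limit [H]. *)
have step n : c k * H / (c k.+1 - I) <= itvint (@hseq R n.+1) 0 1.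
  by rewrite ler_pdivrMr// [X in _ <= X]mulrC -ler_pdivrMr.
have [_ lim] := nonincreasing_limn_ge itvint_hseq_nonincreasing step.
by move: lim; rewrite -/H ler_pdivrMr// [H * _]mulrC ler_pM2r// lerBrDr.
Qed.

(** The [c k] increase and return to [c 0] after [r] steps, so the first surplus cannot be positive,
    as it would be if [c 0 < H]. *)
Let int_periodic_eq : itvint G 0 1 = H.
Proof.
have mono k : c k <= c k.+1.
  have := c_step k; suff : 0 <= itvint (g k.+1) (c k / H) 1 by lra.
  by apply: itvint_ge0 => y /andP[_ y1]; exact: profile_ge0.
have mono1 k : c 1 <= c k.+1.
  by elim: k => [|k IH]; [exact: lexx|exact: le_trans IH (mono _)].
have cr : c r = c 0 by rewrite /c /g perG.
apply/eqP; rewrite eq_le -[itvint G 0 1]/(c 0) c_le_H leNgt; apply/negP => cH.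
have : 0 < itvint (g 1) (c 0 / H) 1.
  have [ng _ g1 _] := g_profile 1; apply: itvint_gt0 => //.
    by rewrite ltr_pdivrMr// mul1r.
  by move=> y; exact: g_gt0.
have := c_step 0; have := mono1 r.-1; rewrite prednK// cr.
by lra.
Qed.

(** Were [G x] below the limit, the decreasing ratio would keep every [hseq n.+1] above a fixed
    multiple, larger than 1, of [G] on [[x, 1]], and the integrals could not tend to that of [G]. *)
Lemma periodic_eq_hlim x : 0 <= x <= 1 -> G x = @hlim R x.
Proof.
move=> x01; have /andP[x0 x1] := x01.
have Gle n : G x <= @hseq R n.+1 x.
  by apply: ratio_le => //; [exact: hseq_profile|exact: (@g_ratio 0)].
have [lim_le G_lim] := nonincreasing_limn_ge (hseq_nonincreasing x01) Gle.
apply/eqP; rewrite eq_le G_lim leNgt; apply/negP; rewrite -/(hlim x) => Glt.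
(* At 1 both [hseq 1] and [G] vanish. *)
have x_lt1 : x < 1.
  rewrite ltNge; apply/negP => x1'; have xE : x = 1 by apply/eqP; rewrite eq_le x1.
  have := lim_le 1%N; rewrite -/(hlim x) => h1x.
  have := lt_le_trans Glt h1x; rewrite xE.
  rewrite -[hseq 1]/(Tmap (@h0 R)) Tmap_eq0// -(@g_eq0 0 1)//.
  by rewrite ltxx.
have [nG _ G1 _] := pG.
have Gx : 0 < G x by exact: (@g_gt0 0).
have T0 : 0 < itvint G x 1.
  by apply: itvint_gt0 => // y; exact: (@g_gt0 0).
pose eps := (@hlim R x / G x - 1) * itvint G x 1.
have eps0 : 0 < eps by rewrite mulr_gt0// subr_gt0 ltr_pdivlMr// mul1r.
have lb n : itvint G 0 1 + eps <= itvint (@hseq R n.+1) 0 1.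
  have [nh _ _ _] := @hseq_profile R n.+1.
  rewrite (itvint_cat nG x0 x1) (itvint_cat nh x0 x1).
  have A : itvint G 0 x <= itvint (@hseq R n.+1) 0 x.
    apply: le_itvint => // y /andP[/ltW y0 yx].
    apply: (ratio_le pG (hseq_profile n.+1) (@g_ratio 0 n)).
    by rewrite y0 (le_trans yx).
  have B : @hlim R x / G x * itvint G x 1 <= itvint (@hseq R n.+1) x 1.
    have k0 : 0 < @hlim R x / G x by rewrite divr_gt0// (lt_trans Gx).
    rewrite -itvintZ//; apply: le_itvint => //.
      by move=> y z yz; rewrite ler_pM2l// nG.
    move=> y /andP[/ltW xy y1]; rewrite mulrAC ler_pdivrMr//.
    have := @g_ratio 0 n x y x0 xy y1; rewrite -/(g 0) [G x * _]mulrC.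
    apply: le_trans; rewrite mulrC ler_wpM2l//; first exact: profile_ge0.
  by move: A B; rewrite /eps mulrBl mul1r; lra.
have [_] := nonincreasing_limn_ge itvint_hseq_nonincreasing lb.
by rewrite -/H int_periodic_eq; lra.
Qed.

End Cycle.
End Periodic.

(** * From functions on the unit interval to profiles on the line *)

Theorem theorem4p9 (R : realType) (r : nat) (g : R -> R) :
  (0 < r)%N ->
  in_E g ->
  (forall x, x \in @unit_itv R -> iter r (@Tmap R) g x = g x) ->
  forall x, x \in @unit_itv R -> g x = @hlim R x.
Proof.
move=> r0 [[_ [g0 gint]] [gdec g1]] per x x01.
have in0 : 0 \in @unit_itv R by rewrite mem_unit_itv lexx ler01.
have in1 : 1 \in @unit_itv R by rewrite mem_unit_itv lexx ler01.
pose gc y := if y < 0 then 1 else if 1 < y then 0 else g y.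
have gcE y : y \in @unit_itv R -> gc y = g y.
  by rewrite mem_unit_itv /gc => /andP[y0 y1]; rewrite ltNge y0 ltNge y1.
have ngc : nonincreasing_fun gc.
  move=> y z yz; rewrite /gc.
  have [y0|y0] := ltP y 0.
    have [//|z0] := ltP z 0; have [_|z1] := ltP 1 z; first exact: ler01.
    by rewrite -[X in _ <= X]g1; apply: gdec => //; rewrite mem_unit_itv z0.
  rewrite ltNge (le_trans y0 yz) /=.
  have [y1|y1] := ltP 1 y; first by rewrite (lt_le_trans y1 yz).
  have [_|z1] := ltP 1 z; first by apply: g0; rewrite mem_unit_itv y0.
  by apply: gdec; rewrite ?mem_unit_itv ?y0 ?(le_trans y0 yz).
have pgc : profile gc.
  split => //; rewrite ?gcE// ?g0//.
  have E : int01 g = (\int[@leb R]_(y in `[0%R, 1%R]%classic) (gc y)%:E)%E.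
    by apply: eq_integral => y y01; rewrite gcE.
  rewrite /itvint /Rintegral -E; apply: fine_gt0; rewrite gint /= E.
  have := integrable_fin_num _ (nonincreasing_integrable 0 1 ngc).
  by rewrite ltey_eq => ->.
(* The periodicity of [gc] is known only on [0, 1]; since [Tmap] reads nothing else, [G] is periodic
   as a function on the whole line. *)
pose G := iter r (@Tmap R) gc.
have itergc n : iter n.+1 (@Tmap R) gc = iter n.+1 (@Tmap R) g.
  by rewrite !iterSr (Tmap_ext gcE).
have GE y : y \in @unit_itv R -> G y = g y.
  by move=> y01; rewrite /G -(prednK r0) itergc prednK// per.
have perG : iter r (@Tmap R) G = G.
  have TG : Tmap G = Tmap gc by apply: Tmap_ext => y y01; rewrite GE// gcE.
  transitivity (iter r (@Tmap R) gc); last by [].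
  by rewrite -(prednK r0) !iterSr TG.
rewrite -GE//; apply: periodic_eq_hlim perG _ _ => //.
  exact: iter_Tmap_profile.
by rewrite -mem_unit_itv.
Qed.
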